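(* Let $G_\sigma$ be a balanced signed graph on $n$ vertices and let $A_\sigma\in\{0,\pm1\}^{n\times n}$ be its signed adjacency matrix. Then \[ \rho_{\mathrm{per}}(A_\sigma)+\eta_{\mathrm{per}}(A_\sigma)=n . \]
   Context: A signed graph $G_\sigma$ is a simple undirected graph with each edge $\{u,v\}$ given a sign $\sigma(u,v)\in\{+1,-1\}$; its signed adjacency matrix has $(u,v)$ entry $\sigma(u,v)$ if $\{u,v\}$ is an edge and $0$ otherwise (so it is symmetric with zero diagonal). A cycle is positive if it contains an even number of negative edges; $G_\sigma$ is balanced if every cycle is positive. For an $m\times m$ matrix $B$, $\mathrm{per}(B)=\sum_{\sigma\in S_m}\prod_i b_{i,\sigma(i)}$. The permanental rank $\rho_{\mathrm{per}}(A)$ is the largest $k$ such that some $k\times k$ submatrix $A[I,J]$ (rows $I$, columns $J$, $|I|=|J|=k$) has nonzero permanent; the permanental nullity $\eta_{\mathrm{per}}(A)$ is the multiplicity of $0$ as a root of $\pi(A,x)=\mathrm{per}(A-xI)$. *)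

(* Defs.v *)
From mathcomp Require Import all_boot all_order all_algebra all_fingroup.

Set Implicit Arguments.
Unset Strict Implicit.
Unset Printing Implicit Defensive.

Import GRing.Theory.
Local Open Scope ring_scope.

(* The value of [sg_sign] outside the edges is irrelevant. *)
Record signed_graph (n : nat) := SignedGraph {
  sg_adj : rel 'I_n;
  sg_sign : 'I_n -> 'I_n -> int;
  sg_adj_sym : symmetric sg_adj;
  sg_adj_irr : irreflexive sg_adj;
  sg_sign_unit : forall u v, sg_adj u v -> sg_sign u v = 1 \/ sg_sign u v = -1;
  sg_sign_sym : forall u v, sg_adj u v -> sg_sign u v = sg_sign v u
}.

Definition signed_adj_mx (F : numFieldType) (n : nat) (G : signed_graph n) :
    'M[F]_n :=
  \matrix_(u, v) (if sg_adj G u v then (sg_sign G u v)%:~R else 0).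

(* A cycle of a simple graph, as the list of its (at least three, pairwise
   distinct) vertices; the bound on the size excludes a single edge traversed
   back and forth. *)
Definition sg_cycle (n : nat) (G : signed_graph n) (c : seq 'I_n) : bool :=
  (2 < size c)%N && ucycleb (sg_adj G) c.

(* [zip c (rot 1 c)] lists the edges of the closed walk through [c], including
   the one from the last vertex back to the first. *)
Definition negative_edges (n : nat) (G : signed_graph n) (c : seq 'I_n) : nat :=
  count (fun uv => sg_sign G uv.1 uv.2 == -1) (zip c (rot 1 c)).

Definition balanced (n : nat) (G : signed_graph n) : Prop :=
  forall c : seq 'I_n, sg_cycle G c -> ~~ odd (negative_edges G c).

Definition permanent (R : comPzRingType) (n : nat) (B : 'M[R]_n) : R :=
  \sum_(s : 'S_n) \prod_(i < n) B i (s i).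

Definition submatrix (R : Type) (m n : nat) (A : 'M[R]_(m, n))
    (I : {set 'I_m}) (J : {set 'I_n}) : 'M[R]_(#|I|, #|J|) :=
  mxsub enum_val enum_val A.

(* When #|I| = #|J| = k, [conform_mx] merely casts the dimensions of A[I, J];
   its default value 0 is never used. *)
Definition has_nz_subpermanent (R : comPzRingType) (m n : nat)
    (A : 'M[R]_(m, n)) (k : nat) : bool :=
  [exists I : {set 'I_m}, exists J : {set 'I_n},
    [&& #|I| == k, #|J| == k &
        permanent (conform_mx (0 : 'M[R]_k) (submatrix A I J)) != 0]].

Definition permanental_rank (R : comPzRingType) (m n : nat)
    (A : 'M[R]_(m, n)) : nat :=
  \max_(k < (minn m n).+1 | has_nz_subpermanent A k) k.

Definition permanental_poly (R : comNzRingType) (n : nat) (A : 'M[R]_n) :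
    {poly R} :=
  permanent (map_mx polyC A - 'X%:M).

Definition permanental_nullity (F : fieldType) (n : nat) (A : 'M[F]_n) : nat :=
  mup 0 (permanental_poly A).

(* Main.v *)
Require Import Defs.
From mathcomp Require Import all_boot all_order all_algebra all_fingroup.

(* Since the adjacency matrix has zero diagonal, per(A - xI) is the sum of
   w(s) (-x)^(fixed points of s) over the permutations s that move every moved
   vertex along an edge. Balance makes the weight w(s) equal to 1: a cycle of s
   of length 2 contributes a squared sign, a longer one is a cycle of the graph.
   So nothing cancels and the nullity is n - r, where r is the largest number
   of vertices moved by such a permutation; likewise the principal submatrix on
   these r vertices has positive permanent. Conversely, a nonzero k x k
   subpermanent yields an injection along edges defined on k vertices. Its
   functional graph consists of cycles and paths, and matching consecutive
   vertices of each path turns it into a permutation moving at least k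
   vertices. *)

Set Implicit Arguments.
Unset Strict Implicit.
Unset Printing Implicit Defensive.

Import Order.TTheory GRing.Theory Num.Theory.
Local Open Scope ring_scope.

(** * Permutations that move vertices along edges *)

Definition moves_along (T : finType) (e : rel T) (s : {perm T}) : bool :=
  [forall x, (s x != x) ==> e x (s x)].

Definition moved (T : finType) (s : {perm T}) : {set T} := [set x | s x != x].

Lemma in_moved (T : finType) (s : {perm T}) x : (x \in moved s) = (s x != x).
Proof. by rewrite inE. Qed.

Lemma moves_alongP (T : finType) (e : rel T) (s : {perm T}) :
  reflect (forall x, s x != x -> e x (s x)) (moves_along e s).
Proof.
by apply: (iffP forallP) => es x; [move/(_ x)/implyP: es | apply/implyP/es].
Qed.

Lemma moves_along1 (T : finType) (e : rel T) : moves_along e 1%g.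
Proof. by apply/moves_alongP=> x; rewrite perm1 eqxx. Qed.

(** Induction on a bound for the size of [I]. If [I] lies in its image, [f] permutes [I] and extends
    by the identity. Locating [moved s] strengthens the induction: it keeps the recursive
    permutation off the swapped pair. *)
Lemma moves_along_of_injection (T : finType) (e : rel T) (f : T -> T)
    (I : {set T}) :
    symmetric e -> irreflexive e ->
    {in I &, injective f} -> {in I, forall x, e x (f x)} ->
  exists s : {perm T}, [/\ moves_along e s, (#|I| <= #|moved s|)%N
    & moved s \subset I :|: f @: I].
Proof.
move=> esym eirr; move: {2}#|I| (leqnn #|I|) => k.
elim: k => [|k IHk] in I *; move=> leIk finj fe.
  exists 1%g; have -> : I = set0 by apply/eqP; rewrite -cards_eq0 -leqn0.
  split; rewrite ?cards0 ?moves_along1 //.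
  by apply/subsetP=> x; rewrite in_moved perm1 eqxx.
have [sIf|] := boolP (I \subset f @: I).
  have /eqP fI : I == f @: I by rewrite eqEcard sIf /= card_in_imset.
  have fin x : x \in I -> f x \in I by move=> xI; rewrite fI imset_f.
  pose g x := if x \in I then f x else x.
  have g_inj : injective g.
    move=> x y; rewrite /g; case: ifPn => xI; case: ifPn => yI //.
    - exact: finj.
    - by move=> fxy; move: yI; rewrite -fxy fin.
    - by move=> fxy; move: xI; rewrite fxy fin.
  have mI : moved (perm g_inj) = I.
    apply/setP=> x; rewrite in_moved permE /g; case: ifPn => xI; last by rewrite eqxx.
    by apply: contraTneq (fe x xI) => ->; rewrite eirr.
  exists (perm g_inj); rewrite mI subsetUl leqnn; split=> //.
  apply/moves_alongP=> x; rewrite permE /g; case: ifPn => [/fe //|].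
  by rewrite eqxx.
(* A vertex [v] outside the image starts a maximal path of [f]: swap it with
   its successor [w] and recurse on the part of [f] that avoids both. *)
case/subsetPn=> v vI vfI; pose w := f v.
have evw : e v w := fe v vI.
have vw : v != w by apply: contraTneq evw => <-; rewrite eirr.
pose I' := I :\: [set v; w].
have sI' : I' \subset I := subsetDl _ _.
(* At most two elements leave [I], as [w] may lie outside it, while the swap adds exactly two moved
   vertices. *)
have cI : (#|I| <= #|I'| + 2)%N.
  rewrite -(cardsID [set v; w] I) addnC leq_add2l.
  by rewrite (leq_trans (subset_leq_card (subsetIr _ _))) // cards2 vw.
have cI' : (#|I'| <= k)%N.
  rewrite -ltnS (leq_trans _ leIk) // proper_card // properE sI' /=.
  by apply/subsetPn; exists v => //; rewrite !inE eqxx.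
have [||s [es cs ss]] := IHk I' cI'.
- by move=> x y /(subsetP sI') xI /(subsetP sI') yI; apply: finj.
- by move=> x /(subsetP sI') xI; apply: fe.
(* [v] is not in [f @: I], and by injectivity [v] is the only preimage of [w] in [I]; so neither
   lies in [I'] or its image. *)
have mv x : s x != x -> (x != v) && (x != w).
  move=> sx; have: x \in moved s by rewrite in_moved.
  move/(subsetP ss); rewrite !inE negb_or => /orP[/andP[//]|/imsetP[y yI' ->]].
  have yI := subsetP sI' y yI'; apply/andP; split.
    by apply: contraNneq vfI => <-; rewrite imset_f.
  move: yI'; rewrite !inE negb_or => /andP[/andP[yv _] _].
  by apply: contraNneq yv => /finj->.
have sv : s v = v by apply/eqP; apply: contraT => /mv; rewrite eqxx.
have sw : s w = w by apply/eqP; apply: contraT => /mv; rewrite eqxx andbF.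
have tE x : (s * tperm v w)%g x =
    if x == v then w else if x == w then v else s x.
  rewrite permM; have [->|xv] := eqVneq x v; first by rewrite sv tpermL.
  have [->|xw] := eqVneq x w; first by rewrite sw tpermR.
  rewrite tpermD // eq_sym.
    by rewrite -sv (inj_eq perm_inj).
  by rewrite -sw (inj_eq perm_inj).
have mt : moved (s * tperm v w)%g = moved s :|: [set v; w].
  apply/setP=> x; rewrite in_moved in_setU in_moved in_set2 tE; have [->|xv] := eqVneq x v.
    by rewrite eq_sym vw orbT.
  by have [->|xw] := eqVneq x w; rewrite ?vw ?orbT ?orbF.
exists (s * tperm v w)%g; split.
- apply/moves_alongP=> x; rewrite tE; have [-> _ //|xv] := eqVneq x v.
  have [-> _|xw] := eqVneq x w; first by rewrite esym.
  exact: (moves_alongP _ _ es).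
- rewrite mt cardsU disjoint_setI0 ?cards0 ?subn0 ?cards2 ?vw.
    by rewrite (leq_trans cI) ?leq_add2r.
  rewrite disjoint_subset; apply/subsetP=> x; rewrite in_moved => /mv.
  by rewrite !inE negb_or.
- rewrite mt; apply/subsetP=> x /setUP[/(subsetP ss)|].
    apply/subsetP/setUSS => //; exact: imsetS.
  by rewrite !inE => /orP[]/eqP->; rewrite ?vI // imset_f ?orbT.
Qed.

(** * Weight of a permutation in a balanced graph *)

Section BalancedWeight.

Variables (n : nat) (G : signed_graph n).
Hypothesis balG : balanced G.
(** [a] will be the identity for the permanental polynomial and the enumeration of a vertex set for
    a principal submatrix. *)
Variables (T : finType) (a : T -> 'I_n).
Hypothesis a_inj : injective a.

Local Notation e := (relpre a (sg_adj G)).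
Local Notation sgn := (sg_sign G).

Lemma prod_sign_count (c : seq ('I_n * 'I_n)) :
    all (fun uv => sg_adj G uv.1 uv.2) c ->
  \prod_(uv <- c) sgn uv.1 uv.2 =
    (-1) ^+ count (fun uv => sgn uv.1 uv.2 == -1) c.
Proof.
elim: c => [|uv c IHc] /=; first by rewrite big_nil.
case/andP=> auv /IHc; rewrite big_cons => ->.
by have [->|->] := sg_sign_unit auv; rewrite ?mul1r // exprS.
Qed.

Lemma prod_sign_porbit (s : {perm T}) (x : T) :
    moves_along e s -> s x != x ->
  \prod_(y in porbit s x) sgn (a y) (a (s y)) = 1.
Proof.
move=> /moves_alongP es sx; set t := traject s x #|porbit s x|.
have Ut : uniq t := uniq_traject_porbit s x.
rewrite (eq_bigl _ _ (porbit_traject s x)) -big_uniq //.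
have movesS y : s y != y -> s (s y) != s y by rewrite (inj_eq perm_inj).
have pathS m y : s y != y -> path e y (traject s (s y) m).
  by elim: m y => //= m IHm y sy; rewrite [sg_adj _ _ _]es // IHm ?movesS.
have map_traject m y : map s (traject s y m) = traject s (s y) m.
  by elim: m y => //= m IHm y; rewrite IHm.
(* [s] shifts the orbit list cyclically, so pairing [c] with its rotation lists the edges from [a y]
   to [a (s y)]. *)
have rot_t : rot 1 t = map s t.
  rewrite /t; case: #|_| (iter_porbit s x) (card_porbit_neq0 s x) => // m it _.
  by rewrite map_traject [RHS]trajectSr -iterSr it /= rot1_cons.
have cyc_t : path.cycle e t.
  rewrite /t; case: #|_| (iter_porbit s x) (card_porbit_neq0 s x) => // m it _ /=.
  by rewrite -[X in rcons _ X]it iterSr -trajectSr pathS.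
have moves_t y : y \in t -> s y != y.
  rewrite /t => /trajectP[i _ ->]; elim: i => //= i; exact: movesS.
pose c := map a t.
have zipc : zip c (rot 1 c) = [seq (a y, a (s y)) | y <- t].
  by rewrite /c -map_rot rot_t -map_comp zip_map.
have [ltc|] := ltnP 2 (size c).
  have /balG : sg_cycle G c.
    by rewrite /sg_cycle ltc /ucycleb map_inj_uniq // Ut andbT path.cycle_map.
  rewrite /negative_edges zipc => even_c.
  have : all (fun uv => sg_adj G uv.1 uv.2) [seq (a y, a (s y)) | y <- t].
    by rewrite all_map; apply/allP=> y /moves_t/es.
  by move/prod_sign_count; rewrite -signr_odd (negPf even_c) big_map.
(* Short orbits: size one contradicts [sx], and size two traverses a single edge twice, giving a
   squared sign. *)
rewrite size_map size_traject /t.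
have := iter_porbit s x; have := card_porbit_neq0 s x.
case: #|_| => [|[|[|//]]] //= _ ssx; first by rewrite ssx eqxx in sx.
rewrite !big_cons big_nil mulr1 ssx => _.
have exy := es x sx; rewrite -(sg_sign_sym exy).
by have [->|->] := sg_sign_unit exy; rewrite ?mulr1 ?mulrNN ?mulr1.
Qed.

(** Each orbit is either moved entirely or a single fixed point, so it contributes an orbit product
    or an empty one. *)
Lemma prod_sign_moves_along (s : {perm T}) : moves_along e s ->
  \prod_(x | s x != x) sgn (a x) (a (s x)) = 1.
Proof.
move=> es; rewrite (partition_big (porbit s) predT) //= big1 // => O _.
have [x /andP[sx /eqP<-]|none] :=
    pickP (fun x => (s x != x) && (porbit s x == O)).
  rewrite -[RHS](prod_sign_porbit es sx); apply: eq_bigl => y.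
  rewrite eq_porbit_mem andb_idl // => /porbitP[i ->].
  elim: i => [|i IHi]; first by rewrite perm1.
  by rewrite expgSr permM (inj_eq perm_inj).
by rewrite big_pred0.
Qed.

Variable F : numFieldType.
Local Notation A := (signed_adj_mx F G).

Lemma prod_adj_moved (s : {perm T}) :
  \prod_(x | s x != x) A (a x) (a (s x)) = (moves_along e s)%:R.
Proof.
case: moves_alongP => [es|nes].
  rewrite -[RHS]/((1 : int)%:~R).
  rewrite -(prod_sign_moves_along (introT (moves_alongP _ _) es)).
  by rewrite rmorph_prod; apply: eq_bigr => x /es /= exs; rewrite mxE exs.
have [x /andP[sx nex]|none] := pickP (fun x => (s x != x) && ~~ sg_adj G (a x) (a (s x))).
  by rewrite (bigD1 x) //= mxE (negPf nex) mul0r.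
case: nes => x sx; have:= none x; rewrite sx /=.
by case: (sg_adj _ _ _).
Qed.

(** A fixed point contributes a zero diagonal entry. So every term of a principal subpermanent is 0
    or 1, and none can cancel. *)
Lemma prod_adj (s : {perm T}) :
  \prod_x A (a x) (a (s x)) = (moves_along e s && (moved s == setT))%:R.
Proof.
have [ms|] := eqVneq (moved s) setT.
  rewrite andbT -prod_adj_moved; apply: eq_bigl => x.
  by rewrite -in_moved ms inE.
rewrite andbF -subTset => /subsetPn[x _]; rewrite in_moved negbK => /eqP sx.
by rewrite (bigD1 x) //= mxE sx sg_adj_irr mul0r.
Qed.

End BalancedWeight.

(** * The permanental polynomial and the nullity *)

Lemma permanental_poly_signed_adj (F : numFieldType) (n : nat)
    (G : signed_graph n) : balanced G ->
  permanental_poly (signed_adj_mx F G) =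
    \sum_(s : 'S_n | moves_along (sg_adj G) s) (- 'X) ^+ (n - #|moved s|).
Proof.
move=> balG; rewrite [RHS]big_mkcond; apply: eq_bigr => s _.
rewrite (bigID (fun i => s i != i)) /=.
rewrite [X in X * _](_ : _ = (moves_along (sg_adj G) s)%:R); last first.
  rewrite -(rmorph_nat (polyC : F -> {poly F})).
  rewrite -(prod_adj_moved balG (@inj_id _) F s) rmorph_prod.
  by apply: eq_bigr => i si; rewrite !mxE eq_sym (negPf si) subr0.
rewrite (eq_bigr (fun=> - 'X)) => [|i]; last first.
  by rewrite negbK => /eqP si; rewrite !mxE si sg_adj_irr eqxx sub0r.
rewrite prodr_const; case: ifP => _; rewrite ?mul0r ?mul1r //; congr (_ ^+ _).
rewrite -[X in (X - _)%N](card_ord n) -(setCK (moved s)) -cardsCs; apply: eq_card => i.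
by rewrite !inE.
Qed.

(** The common value behind both invariants: it will equal the rank, and [n] minus it the
    nullity. *)
Definition max_moved (T : finType) (e : rel T) : nat :=
  \max_(s : {perm T} | moves_along e s) #|moved s|.

Lemma max_moved_attained (T : finType) (e : rel T) :
  exists2 s : {perm T}, moves_along e s & #|moved s| = max_moved e.
Proof.
have [|s es def_s] := @eq_bigmax_cond _ (moves_along e) (fun s => #|moved s|).
  by apply/card_gt0P; exists 1%g; apply: moves_along1.
by exists s.
Qed.

Lemma permanental_nullity_signed_adj (F : numFieldType) (n : nat)
    (G : signed_graph n) : balanced G ->
  permanental_nullity (signed_adj_mx F G) = (n - max_moved (sg_adj G))%N.
Proof.
move=> balG; rewrite /permanental_nullity permanental_poly_signed_adj //.
set r := max_moved _.
have le_r s : moves_along (sg_adj G) s -> (#|moved s| <= r)%N.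
  by move=> es; rewrite /r /max_moved leq_bigmax_cond.
have [s0 es0 def_r] := max_moved_attained (sg_adj G); rewrite -/r in def_r.
have le_n (s : 'S_n) : (#|moved s| <= n)%N by rewrite -[leqRHS]card_ord max_card.
(* Up to sign, [q] is the cofactor of ['X ^+ (n - r)]. At 0 only its terms with exponent 0 survive,
   so its value counts the permutations moving [r] vertices; this is positive, as [s0] is one of
   them. *)
pose q : {poly F} :=
  \sum_(s : 'S_n | moves_along (sg_adj G) s) (- 'X) ^+ (r - #|moved s|).
rewrite (_ : \sum_(s | _) _ = (-1) ^+ (n - r) * q * ('X - 0%:P) ^+ (n - r));
    last first.
  rewrite polyC0 subr0 mulrAC -exprMn mulN1r mulr_sumr; apply: eq_bigr => s es.
  by rewrite -exprD addnBA ?le_r // subnK // -def_r.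
rewrite mupMr ?mup_XsubCX ?eqxx // rootM negb_or.
rewrite /root !hornerE.
rewrite expf_neq0 ?oppr_eq0 ?oner_eq0 //= horner_sum.
have termE (s : 'S_n) : ((- 'X) ^+ (r - #|moved s|)).[0] =
    ((r <= #|moved s|)%N)%:R :> F.
  by rewrite horner_exp hornerN hornerX oppr0 expr0n subn_eq0.
rewrite (bigD1 s0) //= termE def_r leqnn lt0r_neq0 // ltr_pwDl //.
by apply: sumr_ge0 => s _; rewrite termE ler0n.
Qed.

(** * Nonzero subpermanents and the rank *)

Lemma nz_subpermanent_injections (R : idomainType) (m n : nat)
    (A : 'M[R]_(m, n)) (k : nat) : has_nz_subpermanent A k ->
  exists (a : 'I_k -> 'I_m) (b : 'I_k -> 'I_n),
    [/\ injective a, injective b & forall i, A (a i) (b i) != 0].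
Proof.
case/existsP=> I /existsP[J /and3P[/eqP cI /eqP cJ]].
rewrite /conform_mx; case: eqP => // hI; case: eqP => // hJ nz.
pose a i := enum_val (cast_ord (esym hI) i).
pose b i := enum_val (cast_ord (esym hJ) i).
have a_inj : injective a by move=> i j /enum_val_inj/cast_ord_inj.
have b_inj : injective b by move=> i j /enum_val_inj/cast_ord_inj.
(* A nonzero permanent has a term without zero factor, and its permutation matches the chosen rows
   to the chosen columns. *)
have [s nzs|nos] := pickP (fun s : 'S_k => [forall i, A (a i) (b (s i)) != 0]).
  exists a, (b \o s); split=> //; first exact: inj_comp perm_inj.
  exact/forallP.
case/eqP: nz; apply: big1 => s _; apply/eqP/prodf_eq0.
have /negbT := nos s; rewrite negb_forall => /existsP[i]; rewrite negbK => Ai0.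
by exists i; rewrite // castmxE !mxE.
Qed.

Lemma nz_subpermanent_le (F : numFieldType) (n : nat) (G : signed_graph n) k :
  has_nz_subpermanent (signed_adj_mx F G) k -> (k <= max_moved (sg_adj G))%N.
Proof.
case/nz_subpermanent_injections=> a [b [a_inj b_inj nz]].
have e_ab i : sg_adj G (a i) (b i).
  by have := nz i; rewrite mxE; case: ifP => //; rewrite eqxx.
(* [f] sends each chosen row to its matched column; its default value [x] is taken only outside the
   image of [a], where nothing is required of it. *)
pose f x := if [pick i | a i == x] is Some i then b i else x.
have fa i : f (a i) = b i.
  rewrite /f; case: pickP => [j /eqP/a_inj-> //|/(_ i)]; by rewrite eqxx.
have [||s [es cs _]] := @moves_along_of_injection _ _ f (a @: setT)
    (sg_adj_sym G) (sg_adj_irr G).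
- by move=> _ _ /imsetP[i _ ->] /imsetP[j _ ->]; rewrite !fa => /b_inj->.
- by move=> _ /imsetP[i _ ->]; rewrite fa.
move: cs; rewrite card_imset // cardsT card_ord => /leq_trans; apply.
by rewrite /max_moved leq_bigmax_cond.
Qed.

Lemma nz_subpermanent_moved (F : numFieldType) (n : nat) (G : signed_graph n)
    (s : 'S_n) : balanced G -> moves_along (sg_adj G) s ->
  has_nz_subpermanent (signed_adj_mx F G) #|moved s|.
Proof.
move=> balG /moves_alongP es; apply/existsP; exists (moved s).
apply/existsP; exists (moved s); rewrite eqxx conform_mx_id /=.
pose a : 'I_#|moved s| -> 'I_n := enum_val.
have a_inj : injective a := @enum_val_inj _ _.
have a_moved i : s (a i) != a i by rewrite -in_moved; apply: enum_valP.
have sa_in i : s (a i) \in moved s by rewrite in_moved (inj_eq perm_inj).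
(* [s] preserves its set of moved vertices; [g] is its restriction, transported to indices. It
   yields a term equal to 1 among nonnegative ones. *)
pose g i := enum_rank_in (sa_in i) (s (a i)).
have ga i : a (g i) = s (a i) by rewrite /a enum_rankK_in.
have g_inj : injective g.
  by move=> i j /(congr1 a); rewrite !ga => /perm_inj/a_inj.
apply: lt0r_neq0; rewrite /permanent (bigD1 (perm g_inj)) //=.
have termE (t : 'S_#|moved s|) : \prod_i submatrix (signed_adj_mx F G) (moved s) (moved s) i (t i)
    = (moves_along (relpre a (sg_adj G)) t && (moved t == setT))%:R.
  by rewrite -(prod_adj balG a_inj F t); apply: eq_bigr => i _; rewrite [LHS]mxE.
apply: ltr_pwDl; last by apply: sumr_ge0 => t _; rewrite termE ler0n.
rewrite termE ltr0n lt0b; apply/andP; split.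
  by apply/moves_alongP=> i _; rewrite /= permE ga es.
apply/eqP/setP=> i; rewrite in_moved inE permE -(inj_eq a_inj) ga.
exact: a_moved.
Qed.

Theorem theorem4 (F : numFieldType) (n : nat) (G : signed_graph n)
    (balG : balanced G) :
  (permanental_rank (signed_adj_mx F G)
    + permanental_nullity (signed_adj_mx F G))%N = n.
Proof.
have [s es def_r] := max_moved_attained (sg_adj G).
have le_n : (max_moved (sg_adj G) <= n)%N.
  by rewrite -def_r -[leqRHS]card_ord max_card.
rewrite permanental_nullity_signed_adj //.
suff -> : permanental_rank (signed_adj_mx F G) = max_moved (sg_adj G).
  by rewrite subnKC.
(* Injections along edges bound the rank above; the vertices moved by the maximal [s] attain the
   bound. *)
apply/eqP; rewrite eqn_leq; apply/andP; split.
  by apply/bigmax_leqP=> k; apply: nz_subpermanent_le.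
have lt_r : (max_moved (sg_adj G) < (minn n n).+1)%N by rewrite minnn.
rewrite (leq_bigmax_cond (Ordinal lt_r)) //=.
by rewrite -def_r nz_subpermanent_moved.
Qed.
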